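(* For every $\epsilon>0$ there exists $x_0$ such that for all $x>x_0$ the following holds. Let $A\subseteq[1,x]\cap\mathbb{N}$ be a set of integers such that $A+A$ contains no squarefree integer. If $|A|>(\frac{1}{18}+\epsilon)x$, then $A$ is a subset of $4\mathbb{N}$, of $9\mathbb{N}$, or of $4\mathbb{N}+2$.
   Context: $A+A=\{a+b: a,b\in A\}$. For a positive integer $m$ and an integer $r$, $m\mathbb{N}+r$ denotes the set of positive integers congruent to $r$ modulo $m$ (so $4\mathbb{N}$ is the set of positive multiples of $4$, and $4\mathbb{N}+2$ the set of positive integers $\equiv 2 \pmod 4$). *)

(* Defs.v *)
From HB Require Import structures.
From mathcomp Require Import all_boot all_order all_algebra.
Set Implicit Arguments. Unset Strict Implicit. Unset Printing Implicit Defensive.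
Import Order.TTheory GRing.Theory Num.Theory.

Definition squarefree (n : nat) : Prop :=
  (0 < n)%N /\ forall d : nat, (1 < d)%N -> ~~ (d * d %| n)%N.

Definition sumset_no_squarefree (A : seq nat) : Prop :=
  forall a b, a \in A -> b \in A -> ~ squarefree (a + b).

(* Main.v *)
(** Put w = N/36 where N = floor x. Call residues u, v mod 36 conflicting when
u + v is divisible neither by 4 nor by 9. If A meets v and u conflicts with v,
then a + b with a in class u is only divisible by squares of primes >= 5, which
bounds the size of A in class u by w/11 up to O(sqrt N). Splitting further
modulo 25 shows that two conflicting classes that both meet A hold together at
most w/9 elements.

If every class holds at most w/11 elements, pairing u with 1 - u (a conflict)
bounds |A| by 2w = N/18. Otherwise some class u holds more, so A only meets the
12 classes that do not conflict with u. Either each of the other 11 conflicts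
with a class meeting A or misses A, and |A| <= w + 11 (w/11); or some class
z <> u meeting A conflicts with none, and a finite check shows that the classes
conflicting with neither u nor z lie in 4N, 9N, 4N+2 or {u, z}. *)

Require Import Defs.
From HB Require Import structures.
From mathcomp Require Import all_boot all_order all_algebra.
From mathcomp Require Import zify ring lra.
Import Order.TTheory GRing.Theory Num.Theory.
Local Open Scope ring_scope.
Set Implicit Arguments. Unset Strict Implicit. Unset Printing Implicit Defensive.

(** * Conflicting residues and square divisors *)

Definition conflict (u v : nat) : bool := ~~ (4 %| u + v)%N && ~~ (9 %| u + v)%N.

Lemma conflict_mod36 (a b : nat) : conflict (a %% 36) (b %% 36) = conflict a b.
Proof. rewrite /conflict; lia. Qed.

Lemma conflictC (u v : nat) : conflict u v = conflict v u.
Proof. by rewrite /conflict addnC. Qed.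

Lemma not_squarefreeP (n : nat) : (0 < n)%N -> ~ squarefree n ->
  exists2 p, prime p & (p * p %| n)%N.
Proof.
move=> n_gt0 nsf.
have [/hasP[p _ /andP[]]|no_p] :=
  boolP (has (fun p => prime p && (p * p %| n)%N) (iota 0 n.+1)); first by exists p.
case: nsf; split=> // d d_gt1; apply: contra no_p => dd_n.
have pp_n : (pdiv d * pdiv d %| n)%N.
  by apply: dvdn_trans dd_n; apply: dvdn_mul; apply: pdiv_dvd.
apply/hasP; exists (pdiv d); last by rewrite pdiv_prime.
rewrite mem_iota ltnS /=; apply: dvdn_leq => //.
exact: dvdn_trans (dvdn_mulr _ (dvdnn _)) pp_n.
Qed.

(** * Counting in residue classes and sums of inverse squares *)

Lemma size_eqmod (s : seq nat) (m N : nat) : uniq s ->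
  {in s, forall a, (a <= N)%N} -> {in s &, forall a b, a = b %[mod m]} ->
  (size s <= (N %/ m).+1)%N.
Proof.
move=> s_uniq s_le s_mod.
rewrite -(size_map (divn^~ m)) -(size_iota 0 (N %/ m).+1); apply: uniq_leq_size.
  rewrite map_inj_in_uniq // => a b sa sb /= eq_div.
  by rewrite (divn_eq a m) (divn_eq b m) eq_div (s_mod a b).
move=> _ /mapP[a sa ->]; rewrite mem_iota ltnS /=.
exact/leq_div2r/s_le.
Qed.

Lemma size_le_sum_count (T : eqType) (I : Type) (s : seq T) (r : seq I)
    (P : pred I) (E : I -> pred T) :
  {in s, forall a, has (fun i => P i && E i a) r} ->
  (size s <= \sum_(i <- r | P i) count (E i) s)%N.
Proof.
elim: s => //= a s IHs s_has; rewrite big_split /= -add1n leq_add //; last first.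
  by apply: IHs => b sb; rewrite s_has // inE sb orbT.
move: (s_has a (mem_head a s)).
elim: r {IHs s_has} => //= i r IHr; rewrite big_cons.
by case: (P i) => //=; case: (E i a) => //= /IHr.
Qed.

Lemma count_mod (s : seq nat) (P : pred nat) (m : nat) : (0 < m)%N ->
  count P s = (\sum_(k <- iota 0 m) count (fun a => P a && (a %% m == k)%N) s)%N.
Proof.
move=> m_gt0; elim: s => [|a s IHs] /=; first by rewrite big1.
rewrite big_split /= -IHs; congr (_ + _)%N.
rewrite (bigD1_seq (a %% m)%N) ?iota_uniq ?mem_iota ?ltn_mod //= eqxx andbT.
by rewrite big1 ?addn0 // => k; rewrite eq_sym => /negPf ->; rewrite andbF.
Qed.

(* Telescopes against 1/n^2 <= (1/(n-1) - 1/(n+1))/2 over odd n. *)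
Lemma sum_odd_inv_sqr_tail (F : realFieldType) (Z : nat) :
  \sum_(201 <= n < Z | odd n) (n ^ 2)%:R^-1 <= 1 / 400 :> F.
Proof.
have [Z_le|Z_gt] := leqP Z 201; first by rewrite big_geq //; lra.
suff: \sum_(201 <= n < Z | odd n) (n ^ 2)%:R^-1 <= 1 / 400 - (4 * (Z./2)%:R)^-1 :> F.
  have : 0 <= (4 * (Z./2)%:R)^-1 :> F by rewrite invr_ge0 mulr_ge0.
  lra.
elim: Z Z_gt => // Z IHZ; rewrite ltnS leq_eqVlt => /predU1P[<-|Z_gt].
  rewrite big_mkcond big_nat1 [odd 201]/= [201.+1./2]/= natrX; lra.
rewrite big_mkcond big_nat_recr /=; last exact: ltnW.
rewrite -big_mkcond uphalf_half; have := IHZ Z_gt.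
have [Z_odd|Z_even] /= := boolP (odd Z); last by rewrite add0n addr0.
have Z_eq : Z%:R = 1 + (Z./2)%:R * 2 :> F.
  by rewrite -[in LHS](odd_double_half Z) Z_odd -muln2 natrD natrM.
rewrite natrX Z_eq natrD.
have : 0 < (Z./2)%:R :> F by rewrite ltr0n; lia.
move: (Z./2)%:R => h h_gt0.
have -> : (4 * h)^-1 = (4 * (1 + h))^-1 + (4 * h * (1 + h))^-1 by field; lra.
suff: ((1 + h * 2) ^+ 2)^-1 <= (4 * h * (1 + h))^-1 by lra.
rewrite lef_pV2 ?posrE; nra.
Qed.

(** The primes below 201 are summed explicitly and the others are compared with the odd numbers:
    101/2000 + 1/400 = 53/1000. The value must be this sharp, since [class_conflict_le] needs
    (24/25)(53/1000) + 1/25 <= 1/11. *)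
Lemma sum_prime_inv_sqr (F : realFieldType) (Z : nat) :
  \sum_(7 <= p < Z | prime p) (p ^ 2)%:R^-1 <= 53 / 1000 :> F.
Proof.
have term_ge0 m : 0 <= \sum_(m <= p < 201 | prime p) (p ^ 2)%:R^-1 :> F.
  by apply: sumr_ge0 => p _; rewrite invr_ge0.
have small : \sum_(7 <= p < 201 | prime p) (p ^ 2)%:R^-1 <= 101 / 2000 :> F.
  rewrite -big_filter.
  have -> : [seq p <- index_iota 7 201 | prime p] =
    [:: 7; 11; 13; 17; 19; 23; 29; 31; 37; 41; 43; 47; 53; 59; 61; 67; 71; 73;
        79; 83; 89; 97; 101; 103; 107; 109; 113; 127; 131; 137; 139; 149; 151;
        157; 163; 167; 173; 179; 181; 191; 193; 197; 199]%N by [].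
  rewrite !big_cons big_nil !natrX; lra.
have large : \sum_(201 <= p < Z | prime p) (p ^ 2)%:R^-1 <= 1 / 400 :> F.
  apply: le_trans (sum_odd_inv_sqr_tail F Z).
  rewrite big_nat_cond [leRHS]big_nat_cond big_mkcond [leRHS]big_mkcond; apply: ler_sum => p _.
  case: andP => [[/andP[p_ge p_lt] p_prime]|_]; last by case: ifP => _; rewrite ?invr_ge0.
  case: ifP => // /negP[]; rewrite p_ge p_lt /=.
  by case: (even_prime p_prime) p_ge => [->|//].
have [Z_ge|Z_lt] := leqP 201 Z.
  have -> : 53 / 1000 = 101 / 2000 + 1 / 400 :> F by lra.
  by rewrite (big_cat_nat (n := 201)) //=; apply: lerD.
apply: (@le_trans _ _ (101 / 2000)); last lra.
apply: le_trans small; have [Z_ge|/ltnW Z_le] := leqP 7 Z.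
  by rewrite [leRHS](big_cat_nat (n := Z)) ?(ltnW Z_lt) //= lerDl term_ge0.
by rewrite big_geq // term_ge0.
Qed.

(** * Counting elements whose shift is divisible by a large prime square *)

Lemma natr_div_le (F : realFieldType) (N d : nat) : (N %/ d)%:R <= N%:R / d%:R :> F.
Proof.
case: d => [|d]; first by rewrite divn0 invr0 mulr0.
by rewrite ler_pdivlMr ?ltr0n // -natrM ler_nat leq_divM.
Qed.

Lemma sumr_le_const (F : realFieldType) (I : eqType) (r : seq I) (P : pred I)
    (f : I -> F) (c : F) :
  {in r, forall i, P i -> f i <= c} -> \sum_(i <- r | P i) f i <= (count P r)%:R * c.
Proof.
move=> f_le.
have -> : (count P r)%:R * c = \sum_(i <- r | P i) c.
  by rewrite big_const_seq iter_addr_0 mulr_natl.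
by rewrite big_seq_cond [leRHS]big_seq_cond; apply: ler_sum => i /andP[ri /(f_le i ri)].
Qed.

(** A union bound over [p]: since [p ^ 2 <= a + b <= 2 * N], only [p <= Z] occurs, and each [p]
    confines [a] to one class modulo [900 * p ^ 2]. The main terms sum to the prime series; the
    rounding errors, one per prime, total at most [Z]. *)
Lemma count_square_multiples (F : realFieldType) (s : seq nat) (N Z b : nat) :
  uniq s -> {in s, forall a, (0 < a <= N)%N} -> (b <= N)%N -> (2 * N < Z.+1 ^ 2)%N ->
  {in s &, forall a a', (a = a' %[mod 900])%N} ->
  {in s, forall a, exists2 p, prime p && (7 <= p)%N & (p ^ 2 %| a + b)%N} ->
  (size s)%:R <= 53 / 1000 * (N%:R / 900) + Z%:R :> F.
Proof.
move=> s_uniq s_le b_le Z_big s_mod s_sq.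
have bound : (size s <= \sum_(7 <= p < Z.+1 | prime p) (N %/ (900 * p ^ 2)).+1)%N.
  apply: leq_trans (@size_le_sum_count _ _ s (index_iota 7 Z.+1) prime
    (fun p a => p ^ 2 %| a + b)%N _) _.
    move=> a sa; have [p /andP[p_prime p_ge] p_dvd] := s_sq a sa.
    apply/hasP; exists p; last exact/andP.
    rewrite mem_index_iota p_ge /=.
    have /andP[a_gt0 a_le] := s_le a sa.
    have := dvdn_leq (ltn_addr _ a_gt0) p_dvd; move: Z_big; rewrite -!mulnn; nia.
  rewrite big_nat_cond [leqRHS]big_nat_cond.
  apply: leq_sum => p /andP[/andP[p_ge _] p_prime]; rewrite -size_filter.
  apply: size_eqmod => [|a|a a']; first exact: filter_uniq.
    by rewrite mem_filter => /andP[_ /s_le /andP[]].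
  rewrite !mem_filter => /andP[pa sa] /andP[pa' sa'].
  apply/eqP; rewrite chinese_remainder; last first.
    rewrite coprimeXr // -[900%N]/(2 * 2 * (3 * 3 * (5 * 5)))%N !coprimeMl.
    by rewrite !prime_coprime // !dvdn_prime2 //; lia.
  rewrite (s_mod a a') // eqxx /= -(eqn_modDr b).
  by move: pa pa'; rewrite /dvdn => /eqP-> /eqP->.
have {bound} : (size s)%:R <= \sum_(7 <= p < Z.+1 | prime p) (N%:R / 900 * (p ^ 2)%:R^-1 + 1) :> F.
  apply: le_trans (_ : (\sum_(7 <= p < Z.+1 | prime p) (N %/ (900 * p ^ 2)).+1)%:R <= _).
    by rewrite ler_nat.
  rewrite natr_sum; apply: ler_sum => p _.
  rewrite -addn1 natrD lerD2r; apply: le_trans (natr_div_le _ _ _) _.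
  by rewrite natrM invfM mulrA.
rewrite big_split -mulr_sumr /= => /le_trans; apply; apply: lerD.
  by rewrite mulrC ler_wpM2r ?sum_prime_inv_sqr // divr_ge0.
apply: le_trans (sumr_le_const (c := 1) _) _ => //; rewrite mulr1 ler_nat.
by apply: leq_trans (count_size _ _) _; rewrite size_iota; lia.
Qed.

(** * Bounds for the classes modulo 36 *)

Section Residues.
Variables (F : realFieldType) (A : seq nat) (N Z : nat).
Hypotheses (A_uniq : uniq A) (A_bnd : {in A, forall a, (0 < a <= N)%N}).
Hypothesis A_nsf : sumset_no_squarefree A.
Hypotheses (Z_gt0 : (0 < Z)%N) (Z_big : (2 * N < Z.+1 ^ 2)%N).

Let w : F := N%:R / 36.
(** By the Chinese remainder theorem a cell lies in a single class modulo 900 = 36 * 25. *)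
Let cell (u k : nat) : F := (count (fun a => (a %% 36 == u) && (a %% 25 == k))%N A)%:R.
Let n (u : nat) : F := (count (fun a => a %% 36 == u)%N A)%:R.

Fact w_ge0 : 0 <= w. Proof. by rewrite divr_ge0. Qed.
Fact Z_ge1 : 1 <= Z%:R :> F. Proof. by rewrite ler1n. Qed.

Lemma cell_eqmod u k :
  {in [seq a <- A | (a %% 36 == u) && (a %% 25 == k)] &,
    forall a a', (a = a' %[mod 900])%N}%N.
Proof.
move=> a a'; rewrite !mem_filter => /andP[/andP[/eqP au /eqP ak] _].
move=> /andP[/andP[/eqP a'u /eqP a'k] _].
apply/eqP; rewrite (@chinese_remainder 36 25) //.
by rewrite au a'u ak a'k !eqxx.
Qed.

Lemma cell_le u k : cell u k <= w / 25 + 1.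
Proof.
rewrite /cell -size_filter.
apply: le_trans (_ : (N %/ 900).+1%:R <= _).
  rewrite ler_nat; apply: size_eqmod; last exact: cell_eqmod.
    exact: filter_uniq.
  by move=> a; rewrite mem_filter => /andP[_ /A_bnd /andP[]].
rewrite -addn1 natrD lerD2r; apply: le_trans (natr_div_le _ _ _) _.
by rewrite /w; lra.
Qed.

Lemma cell_conflict_le u k b : b \in A -> conflict u b -> ~~ (25 %| k + b)%N ->
  cell u k <= 53 / 1000 * (w / 25) + Z%:R.
Proof.
move=> bA /andP[n4 n9] n25; have /andP[b_gt0 b_le] := A_bnd bA.
have -> : w / 25 = N%:R / 900 by rewrite /w; lra.
rewrite /cell -size_filter; apply: (@count_square_multiples _ _ N Z b) => //.
- exact: filter_uniq.
- by move=> a; rewrite mem_filter => /andP[_ /A_bnd].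
- exact: cell_eqmod.
move=> a; rewrite mem_filter => /andP[/andP[/eqP au /eqP ak] aA].
have /andP[a_gt0 _] := A_bnd aA.
have [|p p_prime p_dvd] := @not_squarefreeP (a + b) _ (A_nsf aA bA).
  by rewrite addn_gt0 a_gt0.
exists p; rewrite -?mulnn ?p_prime //=.
(* The primes 2, 3 and 5 are excluded by [n4], [n9] and [n25]. *)
case: p p_prime p_dvd => [|[|[|[|[|[|[|p]]]]]]] //= _; lia.
Qed.

Lemma class_sum_cells u : n u = \sum_(k <- iota 0 25) cell u k.
Proof. by rewrite /n (count_mod _ _ (isT : (0 < 25)%N)) natr_sum. Qed.

Lemma class_le u : n u <= w + 25 * Z%:R.
Proof.
have Z_ge1 := Z_ge1.
rewrite class_sum_cells; apply: le_trans (sumr_le_const (c := w / 25 + 1) _) _.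
  by move=> k _ _; apply: cell_le.
by rewrite count_predT size_iota; lra.
Qed.

(** One cell gets only the trivial bound [w / 25], the other 24 are sieved by primes from 7 on: 1/25
    + (24/25)(53/1000) = 0.09088 < 1/11. *)
Lemma class_conflict_le u b : b \in A -> conflict u b -> n u <= w / 11 + 25 * Z%:R.
Proof.
have w_ge0 := w_ge0; have Z_ge1 := Z_ge1.
move=> bA ub; rewrite class_sum_cells.
(* 24 = -1 mod 25, so [k0] is the only class mod 25 where 25 may divide a + b. *)
set k0 := (24 * b %% 25)%N.
rewrite (bigD1_seq k0) ?iota_uniq ?mem_iota ?ltn_mod //=.
have rest_le : {in iota 0 25, forall k, k != k0 -> cell u k <= 53 / 1000 * (w / 25) + Z%:R}.
  move=> k; rewrite mem_iota => /andP[_ k_lt] k_neq.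
  by apply: cell_conflict_le bA ub _; lia.
have count_rest : count (fun k => k != k0) (iota 0 25) = 24%N.
  by rewrite /k0; move: (24 * b %% 25)%N (ltn_pmod (24 * b) (isT : 0 < 25)%N); do 25?case=> //.
have {rest_le} := sumr_le_const rest_le; rewrite count_rest.
have := cell_le u k0; lra.
Qed.

(** No [k] has 25 dividing both [k + b] and [k + b'], so every cell is sieved by one of the two and
    the exceptional cell disappears. *)
Lemma class_conflict_spread u b b' : b \in A -> b' \in A -> conflict u b -> conflict u b' ->
  b != b' %[mod 25] -> n u <= 53 / 1000 * w + 25 * Z%:R.
Proof.
move=> bA b'A ub ub' bb'; rewrite class_sum_cells.
apply: le_trans (sumr_le_const (c := 53 / 1000 * (w / 25) + Z%:R) _) _.
  move=> k _ _; have [kb|kb] := boolP (25 %| k + b)%N.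
    by apply: cell_conflict_le b'A ub' _; lia.
  exact: cell_conflict_le bA ub kb.
by rewrite count_predT size_iota; lra.
Qed.

Lemma class_concentrated v l :
  {in A, forall b, (b %% 36 = v -> b %% 25 = l)%N} -> n v = cell v l.
Proof.
move=> conc; congr _%:R; apply: eq_in_count => b /conc.
by case: eqP => //= bv ->; rewrite ?eqxx.
Qed.

(** The class of [b] is a single cell. Either some member of the class of [a] sieves that cell, and
    1/11 + 53/25000 < 1/9, or the class of [a] is a single cell too, and 2/25 < 1/9. *)
Lemma class_pair_concentrated a b : a \in A -> b \in A -> conflict a b ->
  {in A, forall b', (b' = b %[mod 36] -> b' = b %[mod 25])%N} ->
  n (a %% 36)%N + n (b %% 36)%N <= w / 9 + 50 * Z%:R.
Proof.
have w_ge0 := w_ge0; have Z_ge1 := Z_ge1.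
move=> aA bA ab conc; rewrite (class_concentrated conc).
have [/hasP[a' a'A /andP[/eqP a'a n25]]|] :=
    boolP (has (fun a' => (a' %% 36 == a %% 36)%N && ~~ (25 %| a' + b)%N) A).
  have := @cell_conflict_le (b %% 36)%N (b %% 25)%N a' a'A.
  rewrite conflictC -conflict_mod36 modn_mod a'a conflict_mod36 => /(_ ab).
  have -> : ~~ (25 %| b %% 25 + a')%N by lia.
  move=> /(_ isT); have := @class_conflict_le (a %% 36)%N b bA.
  rewrite -conflict_mod36 modn_mod conflict_mod36 => /(_ ab); lra.
(* Now 25 divides [a' + b] for every [a'] of [A] in the class of [a], which fixes [a'] modulo 25. *)
move=> /hasPn none.
rewrite (@class_concentrated (a %% 36)%N (24 * b %% 25)%N) => [|a' a'A a'a].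
  have := cell_le (a %% 36)%N (24 * b %% 25)%N.
  have := cell_le (b %% 36)%N (b %% 25)%N; lra.
by have := none a' a'A; rewrite a'a eqxx /=; lia.
Qed.

(** If neither class is concentrated in one residue modulo 25, each spreads and bounds the other,
    and 2(53/1000) < 1/9. *)
Lemma class_pair_le a b : a \in A -> b \in A -> conflict a b ->
  n (a %% 36)%N + n (b %% 36)%N <= w / 9 + 50 * Z%:R.
Proof.
have w_ge0 := w_ge0; have Z_ge1 := Z_ge1.
move=> aA bA ab.
have spreadP (x y : nat) : x \in A -> y \in A -> conflict x y ->
    n (x %% 36)%N <= 53 / 1000 * w + 25 * Z%:R \/
    {in A, forall b', (b' = y %[mod 36] -> b' = y %[mod 25])%N}.
  move=> xA yA xy.
  have [/hasP[b' b'A /andP[/eqP b'y y25]]|/hasPn none] :=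
    boolP (has (fun b' => (b' %% 36 == y %% 36)%N && (b' %% 25 != y %% 25)%N) A).
    left; apply: (@class_conflict_spread _ b' y) => //;
      by rewrite -conflict_mod36 modn_mod ?b'y conflict_mod36.
  by right=> b' b'A b'y; have := none b' b'A; rewrite b'y eqxx negbK => /eqP.
have [a_le|conc] := spreadP a b aA bA ab; last exact: class_pair_concentrated.
have ba : conflict b a by rewrite conflictC.
have [b_le|conc] := spreadP b a bA aA ba; first by lra.
by rewrite addrC; apply: class_pair_concentrated.
Qed.

End Residues.

(** * Combinatorics of the 36 classes *)

(** The classes not conflicting with [u] are those congruent to [-u] modulo 4 (nine) or modulo 9
    (four), with one in common: twelve, and [u] itself is among them. *)
Lemma count_nonconflict (u : nat) : (u < 36)%N -> ~~ conflict u u ->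
  count (fun v => (v != u) && ~~ conflict u v) (iota 0 36) = 11%N.
Proof.
move=> u_lt uu.
have check : all (fun u => ~~ conflict u u ==>
    (count (fun v => (v != u) && ~~ conflict u v) (iota 0 36) == 11)%N) (iota 0 36).
  by vm_compute.
have /allP/(_ u) := check; rewrite mem_iota => /(_ u_lt).
by rewrite uu => /eqP.
Qed.

Definition common_nonconflict (u w : nat) : seq nat :=
  [seq v <- iota 0 36 | ~~ conflict u v && ~~ conflict w v].

Lemma common_nonconflict_cases (u w : nat) : (u < 36)%N -> (w < 36)%N -> u != w ->
  ~~ conflict u u -> ~~ conflict w w -> ~~ conflict u w ->
  [|| all (fun v => v %% 4 == 0)%N (common_nonconflict u w),
      all (fun v => v %% 9 == 0)%N (common_nonconflict u w),
      all (fun v => v %% 4 == 2)%N (common_nonconflict u w) |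
      all (mem [:: u; w]) (common_nonconflict u w)].
Proof.
move=> u_lt w_lt uw u_self w_self uw_nc.
have check : all (fun u => all (fun w =>
    [&& u != w, ~~ conflict u u, ~~ conflict w w & ~~ conflict u w] ==>
    [|| all (fun v => v %% 4 == 0)%N (common_nonconflict u w),
        all (fun v => v %% 9 == 0)%N (common_nonconflict u w),
        all (fun v => v %% 4 == 2)%N (common_nonconflict u w) |
        all (mem [:: u; w]) (common_nonconflict u w)])
    (iota 0 36)) (iota 0 36).
  by vm_compute.
have /allP/(_ u) := check; rewrite mem_iota => /(_ u_lt)/allP/(_ w).
by rewrite mem_iota => /(_ w_lt)/implyP; apply; apply/and4P.
Qed.

(** Here [T] marks the classes that meet [A] and [e] absorbs the error of order sqrt(N). As 2w =
    N/18, the first alternative will contradict the size of [A]. *)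
Lemma class_weights (F : realFieldType) (n : nat -> F) (T : pred nat) (w e : F) :
  0 <= w -> 0 <= e ->
  (forall u, ~~ T u -> n u = 0) ->
  (forall u, n u <= w + e) ->
  (forall u v, T v -> conflict u v -> n u <= w / 11 + e) ->
  (forall u v, T u -> T v -> conflict u v -> n u + n v <= w / 9 + 2 * e) ->
  \sum_(u <- iota 0 36) n u <= 2 * w + 36 * e \/
  [\/ {in iota 0 36, forall u, T u -> u %% 4 = 0}%N,
      {in iota 0 36, forall u, T u -> u %% 9 = 0}%N |
      {in iota 0 36, forall u, T u -> u %% 4 = 2}%N].
Proof.
move=> w_ge0 e_ge0 n0 n_le n_conf n_pair.
have [/hasP[u]|/hasPn small] := boolP (has (fun u => w / 11 + e < n u) (iota 0 36)); last first.
  (* Since [u + (37 - u)] is 1 modulo 36, the two classes conflict. Summing over all [u] counts each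
     class twice, whence the factor 36 for a bound of 2w + 36e. *)
  left; have swap : perm_eq (iota 0 36) [seq (37 - u) %% 36 | u <- iota 0 36]%N by [].
  suff : \sum_(u <- iota 0 36) (n u + n ((37 - u) %% 36)%N) <= 36%:R * (w / 9 + 2 * e).
    rewrite big_split /= -(big_map (fun u => (37 - u) %% 36)%N xpredT n).
    by rewrite -(perm_big _ swap) /=; lra.
  apply: sumr_le_const => u u_in _.
  have := small u u_in; rewrite -leNgt => u_le.
  have := small ((37 - u) %% 36)%N; rewrite mem_iota ltn_mod -leNgt => /(_ isT) v_le.
  have [Tu|/n0->] := boolP (T u); last by lra.
  have [Tv|/n0->] := boolP (T ((37 - u) %% 36)%N); last by lra.
  apply: n_pair => //; move: u_in; rewrite mem_iota /conflict; lia.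
move=> u_in u_big.
have u_lt : (u < 36)%N by rewrite mem_iota in u_in.
have Tu : T u by apply/negPn/negP => /n0 u0; move: u_big; rewrite u0; lra.
have T_near v : T v -> ~~ conflict u v.
  by move=> Tv; apply/negP => /(n_conf _ _ Tv); rewrite leNgt u_big.
have [/hasP[z z_in /and3P[zu Tz /hasPn z_free]]|/hasPn others] :=
    boolP (has (fun z => [&& z != u, T z & ~~ has (fun v => T v && conflict z v) (iota 0 36)])
      (iota 0 36)).
  have T_z v : v \in iota 0 36 -> T v -> ~~ conflict z v.
    by move=> /z_free; case: (T v).
  have z_lt : (z < 36)%N by rewrite mem_iota in z_in.
  have uz : u != z by rewrite eq_sym.
  have T_common v : v \in iota 0 36 -> T v -> v \in common_nonconflict u z.
    by move=> v_in Tv; rewrite mem_filter v_in T_near ?T_z.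
  have := common_nonconflict_cases u_lt z_lt uz (T_near _ Tu) (T_z _ z_in Tz) (T_near _ Tz).
  case/or4P => /allP sub.
  - by right; apply: Or31 => v v_in Tv; apply/eqP/sub/T_common.
  - by right; apply: Or32 => v v_in Tv; apply/eqP/sub/T_common.
  - by right; apply: Or33 => v v_in Tv; apply/eqP/sub/T_common.
  (* Only [u] and [z] can meet [A], so the total is at most 2(w + e). *)
  left; rewrite (bigD1_seq u) ?iota_uniq //= big_mkcond.
  rewrite (bigD1_seq z) ?iota_uniq //= zu big_seq_cond big1 => [|v /andP[v_in vz]].
    by have := n_le u; have := n_le z; lra.
  case: ifP => // vu; apply: n0; apply/negP => /(T_common _ v_in)/sub.
  by rewrite !inE (negPf vz) (negPf vu).
(* Classes conflicting with [u] are empty; the rest give (w + e) + 11(w/11 + e) = 2w + 12e. *)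
left; rewrite (bigD1_seq u) ?iota_uniq //=.
rewrite (bigID (conflict u)) /= big1 => [|v /andP[_ uv]]; last first.
  by apply: n0; apply: contraL uv => /T_near.
have := @sumr_le_const _ _ (iota 0 36) (fun v => (v != u) && ~~ conflict u v) n (w / 11 + e).
rewrite count_nonconflict ?T_near // => sum_le.
suff /sum_le : {in iota 0 36, forall v, (v != u) && ~~ conflict u v -> n v <= w / 11 + e}.
  by have := n_le u; lra.
move=> v v_in /andP[vu _]; have [Tv|/n0->] := boolP (T v); last by lra.
have := others v v_in; rewrite vu Tv negbK => /hasP[z _ /andP[Tz]].
exact: n_conf.
Qed.

(** * Choice of the threshold and conclusion *)

Lemma exists_sqrt (n : nat) : exists Z, (Z ^ 2 <= n < Z.+1 ^ 2)%N.
Proof.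
elim: n => [|n [Z /andP[Z_le Z_gt]]]; first by exists 0.
have [lt|ge] := ltnP n.+1 (Z.+1 ^ 2); first by exists Z; rewrite lt leqW.
by exists Z.+1; rewrite ge; move: Z_gt; rewrite -!mulnn; nia.
Qed.

Theorem theorem1 (R : archiFieldType) :
  forall eps : R, 0 < eps ->
  exists x0 : R, forall x : R, x0 < x ->
  forall A : seq nat, uniq A ->
    (forall a, a \in A -> (1 <= a)%N /\ (a%:R <= x)) ->
    sumset_no_squarefree A ->
    (1 / 18 + eps) * x < (size A)%:R ->
    (forall a, a \in A -> (a %% 4 = 0)%N) \/
    (forall a, a \in A -> (a %% 9 = 0)%N) \/
    (forall a, a \in A -> (a %% 4 = 2)%N).
Proof.
(* The threshold forces [Z > 1800 / eps], where [Z] is the integer part of sqrt(2N); the [+ 2]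
   absorbs the rounding of [x] to [N] and of the root to [Z]. *)
move=> eps eps_gt0; exists ((1800 / eps + 2) ^+ 2) => x x_gt A A_uniq A_bnd A_nsf A_big.
have c_gt0 : 0 < 1800 / eps by rewrite divr_gt0.
have x_gt0 : 0 < x by apply: le_lt_trans x_gt; apply: sqr_ge0.
have [N [N_le N_gt]] : exists N : nat, N%:R <= x /\ x < N%:R + 1.
  by exists (Num.truncn x); apply/andP; rewrite natr1; apply/truncn_itv/ltW.
have {}A_bnd : {in A, forall a, (0 < a <= N)%N}.
  move=> a /A_bnd[-> a_le] /=; rewrite -ltnS -(ltr_nat R) -natr1.
  exact: le_lt_trans N_gt.
have [Z /andP[Z_le Z_gt]] := exists_sqrt (2 * N).
have Z_lt : 1800 / eps < Z%:R.
  rewrite ltNge; apply/negP => Z_small; move: Z_gt.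
  rewrite ltnNge -(ler_nat R) natrX natrM -natr1 => /negP[].
  move: (Z%:R) (ler0n R Z) Z_small => z z_ge0 z_le.
  have : (z + 1) ^+ 2 <= (1800 / eps + 1) ^+ 2 by rewrite lerXn2r ?nnegrE; lra.
  move: (1800 / eps) c_gt0 x_gt => c c_gt0 x_gt; nra.
have Z_gt0 : (0 < Z)%N by rewrite -(ltr0n R); apply: lt_trans Z_lt.
pose n u : R := (count (fun a => a %% 36 == u)%N A)%:R.
have n0 u : ~~ has (fun a => a %% 36 == u)%N A -> n u = 0.
  by rewrite has_count -leqNgt leqn0 /n => /eqP->.
have [|||||A_le|sub] := @class_weights _ n
    (fun u => has (fun a => a %% 36 == u)%N A) (N%:R / 36) (25 * Z%:R) _ _ n0.
- by rewrite divr_ge0.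
- by rewrite mulr_ge0.
- by move=> u; apply: class_le.
- move=> u v /hasP[b bA /eqP <-] ub.
  rewrite -conflict_mod36 modn_mod conflict_mod36 in ub.
  exact: (class_conflict_le _ A_uniq A_bnd A_nsf Z_gt0 Z_gt bA ub).
- move=> u v /hasP[a aA /eqP <-] /hasP[b bA /eqP <-]; rewrite conflict_mod36.
  move=> /(class_pair_le (R : realFieldType) A_uniq A_bnd A_nsf Z_gt0 Z_gt aA bA); lra.
- have A_sum : \sum_(u <- iota 0 36) n u = (size A)%:R.
    by rewrite -natr_sum -count_predT (count_mod _ _ (isT : (0 < 36)%N)).
  rewrite A_sum in A_le.
  suff : (1 / 18 + eps) * x < (1 / 18 + eps) * x by rewrite ltxx.
  apply: lt_le_trans A_big _; apply: le_trans A_le _.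
  (* The total error is 36 * 25 * Z = 900Z, and 900Z < eps Z^2 / 2 <= eps x. *)
  have eps_z : 1800 < Z%:R * eps by rewrite -ltr_pdivrMr.
  have zz_le : Z%:R ^+ 2 <= 2 * x.
    apply: le_trans (_ : 2 * N%:R <= _); last by rewrite ler_pM2l.
    by rewrite -natrX -natrM ler_nat.
  nra.
- have mod36 a : a \in A -> (a %% 36)%N \in iota 0 36 /\ has (fun b => b %% 36 == a %% 36)%N A.
    by move=> aA; rewrite mem_iota ltn_mod; split=> //; apply/hasP; exists a.
  case: sub => sub; [left | right; left | right; right] => a aA;
    have [a_in Ta] := mod36 a aA; rewrite -(@modn_dvdm 36) //; exact: sub.
Qed.
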